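(* Let $K\ge 1$ and let $M_1,\dots,M_K,N_1,\dots,N_K$ be positive integers. For generic channel matrices $(\mathbf{H}_{kj})_{k,j=1}^K$, $\mathbf{H}_{kj}\in\mathbb{C}^{N_k\times M_j}$ (no channel extension), the following hold. (a) If the tuple $(d_1,\dots,d_K)$ with $d_k=d$ for all $k$ is achievable through linear interference alignment, then $$d\ \le\ \frac{1}{K(K+1)}\sum_{k=1}^K(M_k+N_k).$$ (b) Suppose there are positive integers $M,N$ with $M_k+N_k=M+N$ for all $k$. If the tuple $(d_1,\dots,d_K)$ is achievable through linear interference alignment, then $$\Big(\sum_{k=1}^Kd_k\Big)^2+\sum_{k=1}^Kd_k^2\ \le\ (M+N)\sum_{k=1}^Kd_k,$$ and consequently $$\sum_{k=1}^Kd_k\ <\ M+N.$$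
   Context: Setting: a $K$-user flat fading MIMO interference channel in which transmitter $k$ has $M_k$ antennas and receiver $k$ has $N_k$ antennas. The channel from transmitter $j$ to receiver $k$ is a complex matrix $\mathbf{H}_{kj}$ of size $N_k\times M_j$. Achievability through linear interference alignment: for given channel matrices $(\mathbf{H}_{kj})_{k,j=1}^K$, a tuple $(d_1,\dots,d_K)$ of nonnegative integers is achievable through linear interference alignment (without channel extension) if there exist matrices $\mathbf{V}_k\in\mathbb{C}^{M_k\times d_k}$ and $\mathbf{U}_k\in\mathbb{C}^{N_k\times d_k}$, $k=1,\dots,K$, such that $$\mathbf{U}_k^H\mathbf{H}_{kj}\mathbf{V}_j=\mathbf{0}\ \text{ for all } j\neq k,\qquad \operatorname{rank}(\mathbf{U}_k^H\mathbf{H}_{kk}\mathbf{V}_k)=d_k\ \text{ for all } k,$$ where $(\cdot)^H$ is the conjugate transpose. Generic: a property holds for generic channel matrices if it holds for all $(\mathbf{H}_{kj})_{k,j}$ in some nonempty Zariski open subset of $\prod_{k,j=1}^K\mathbb{C}^{N_k\times M_j}$ (in particular, almost surely when the entries are drawn from a continuous probability distribution). *)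

(* Defs.v *)
From HB Require Import structures.
From mathcomp Require Import all_boot all_order all_algebra.
From mathcomp Require Import reals complex mpoly.

Set Implicit Arguments.
Unset Strict Implicit.
Unset Printing Implicit Defensive.

Import Order.TTheory GRing.Theory Num.Theory.
Local Open Scope ring_scope.

Section InterferenceChannel.

Variables (C : numClosedFieldType) (K : nat) (M N : 'I_K -> nat).

(* H k j is the matrix of the channel from transmitter j to receiver k. *)
Definition channel := forall k j : 'I_K, 'M[C]_(N k, M j).

Definition conjtr m n (A : 'M[C]_(m, n)) : 'M[C]_(n, m) :=
  map_mx Num.conj A^T.

Definition LIA_achievable (H : channel) (d : 'I_K -> nat) : Prop :=
  exists (V : forall k, 'M[C]_(M k, d k)) (U : forall k, 'M[C]_(N k, d k)),
    (forall k j, j != k -> conjtr (U k) *m H k j *m V j = 0) /\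
    (forall k, \rank (conjtr (U k) *m H k k *m V k) = d k).

(* The positions ((k, j), (a, b)) of the scalar entries H k j a b; they index
   the coordinates of the affine space of all channels. *)
Definition entry := {kj : 'I_K * 'I_K & ('I_(N kj.1) * 'I_(M kj.2))%type}.

Definition coords (H : channel) (i : 'I_#|{: entry}|) : C :=
  let e := enum_val i in
  H (tag e).1 (tag e).2 (tagged e).1 (tagged e).2.

Definition zariski_open (O : channel -> Prop) : Prop :=
  exists S : {mpoly C[#|{: entry}|]} -> Prop,
    forall H, O H <-> exists p, S p /\ p.@[coords H] != 0.

Definition generic (P : channel -> Prop) : Prop :=
  exists O : channel -> Prop,
    [/\ zariski_open O, (exists H, O H) & forall H, O H -> P H].

End InterferenceChannel.

(* Main.v *)
Require Import Defs.
From HB Require Import structures.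
From mathcomp Require Import all_boot all_order all_algebra.
From mathcomp Require Import zify.
From mathcomp Require Import reals complex mpoly.
From mathcomp Require boolp.

Set Implicit Arguments.
Unset Strict Implicit.
Unset Printing Implicit Defensive.

Import Order.TTheory GRing.Theory Num.Theory.
Local Open Scope ring_scope.

(* A dimension count. After a change of basis, a solution (U, V) for the stream
   numbers d_k contains identity blocks, so the W_k = U_k^H and the V_k carry
   \sum_k d_k (M_k + N_k - 2 d_k) free entries, and the alignment equations
   express \sum_(k != j) d_k d_j entries of the channel polynomially in the
   other ones. If (\sum_k d_k)^2 + \sum_k d_k^2 > \sum_k d_k (M_k + N_k), then
   the alignable channels are the image of a polynomial map from an affine
   space of smaller dimension, hence satisfy a nonzero polynomial equation.
   Only finitely many d and positions of the identity blocks occur, and the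
   product of the corresponding polynomials cuts out a nonempty open set. *)

(** * Points where a nonzero polynomial does not vanish *)

(** In characteristic zero the numbers 0, ..., [size p - 1] are [size p] distinct points, too many
    to be all roots. *)
Lemma exists_nonroot (F : numDomainType) (p : {poly F}) :
  p != 0 -> exists t, p.[t] != 0.
Proof.
move=> p0; pose s := [seq (i%:R : F) | i <- iota 0 (size p)].
have us : uniq s by rewrite map_inj_uniq ?iota_uniq // => i j /eqP; rewrite eqr_nat => /eqP.
case: (boolP (all (root p) s)) => [rs|/allPn[t _ rt]]; last by exists t.
by have := max_poly_roots p0 rs us; rewrite size_map size_iota ltnn.
Qed.

(** Induction on [n], reading off the lowest digit modulo [B]. It makes distinct monomials keep
    distinct exponents under Kronecker substitution. *)
Lemma base_digits_inj B n (u v : 'I_n -> nat) :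
  (forall i, u i < B)%N -> (forall i, v i < B)%N ->
  (\sum_i u i * B ^ i = \sum_i v i * B ^ i)%N -> u =1 v.
Proof.
elim: n u v => [|n IH] u v hu hv; first by move=> _ [].
have B0 : (0 < B)%N by apply: leq_ltn_trans (hu ord0).
have step (w : 'I_n.+1 -> nat) : (\sum_i w i * B ^ i =
    (\sum_(i < n) w (lift ord0 i) * B ^ i) * B + w ord0)%N.
  rewrite big_ord_recl expn0 muln1 addnC big_distrl /=; congr addn.
  by apply: eq_bigr => i _; rewrite /bump add1n expnSr mulnA.
rewrite !step => E.
have E0 : u ord0 = v ord0.
  by have /(congr1 (modn^~ B)) := E; rewrite !modnMDl !modn_small.
move/eqP: E; rewrite E0 eqn_add2r eqn_pmul2r // => /eqP /IH E.
move=> i; case: (unliftP ord0 i) => [j|] -> //; exact: E.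
Qed.

(* Kronecker substitution [x_i = t ^ (B ^ i)] with [B] above all exponents. *)
Lemma mpoly_nonzero_eval (F : numDomainType) n (p : {mpoly F[n]}) :
  p != 0 -> exists v, p.@[v] != 0.
Proof.
move=> p0; pose B := msize p; pose code (m : 'X_{1..n}) := (\sum_i m i * B ^ i)%N.
pose P : {poly F} := \sum_(m <- msupp p) p@_m *: 'X^(code m).
have ltB m i : m \in msupp p -> (m i < B)%N.
  move=> hm; apply: leq_ltn_trans (msize_mdeg_lt hm).
  by rewrite mdegE (bigD1 i) //= leq_addr.
have P0 : P != 0.
  have hm := mlead_supp p0; apply/eqP => /(congr1 (fun q : {poly F} => q`_(code (mlead p)))).
  rewrite coef0 coef_sum (bigD1_seq (mlead p)) ?msupp_uniq //= coefZ coefXn eqxx mulr1.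
  rewrite big_seq_cond big1 ?addr0 => [/eqP|m /andP[hm' ne]].
    by rewrite mleadc_eq0 (negPf p0).
  rewrite coefZ coefXn; case: eqP => [E|_]; last by rewrite mulr0.
  case/eqP: ne; apply/mnmP; apply: (@base_digits_inj B) => // i; exact: ltB.
have [t ht] := exists_nonroot P0; exists (fun i : 'I_n => t ^+ (B ^ i)%N).
move: ht; rewrite mevalE horner_sum.
rewrite (eq_bigr (fun m => p@_m * \prod_(i < n) (t ^+ (B ^ i)%N) ^+ m i)) // => m _.
rewrite hornerZ hornerXn /code; congr (_ * _).
by rewrite expr_sum; apply: eq_bigr => i _; rewrite -exprM mulnC.
Qed.

(** * Algebraic dependence of polynomials that outnumber their variables *)

Lemma exists_left_kernel (F : fieldType) m n (A : 'M[F]_(m, n)) :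
  (n < m)%N -> exists2 v : 'rV_m, v != 0 & v *m A = 0.
Proof.
move=> nm; have : kermx A != 0.
  by rewrite -mxrank_eq0 mxrank_ker subn_eq0 -ltnNge; apply: leq_ltn_trans nm; apply: rank_leq_col.
by case/rowV0Pn => v /sub_kermxP vA v0; exists v.
Qed.

(** [msize] is the degree plus one, and 0 for the zero polynomial; with successors the bounds add
    like degrees and the zero case fits in. *)
Lemma msizeM_leS (F : idomainType) n (p q : {mpoly F[n]}) s t :
  (msize p <= s.+1 -> msize q <= t.+1 -> msize (p * q) <= (s + t).+1)%N.
Proof.
have [->|p0] := eqVneq p 0; first by rewrite mul0r msize0.
have [->|q0] := eqVneq q 0; first by rewrite mulr0 msize0.
move=> hp hq; rewrite msizeM // -subn1 leq_subLR add1n -addSn -addnS.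
exact: leq_add.
Qed.

Lemma msize_prod_le (F : idomainType) n e (I : finType) (G : I -> {mpoly F[n]}) (m : I -> nat) :
  (forall i, msize (G i) <= e.+1)%N ->
  (msize (\prod_i G i ^+ m i) <= (\sum_i m i * e).+1)%N.
Proof.
move=> hG; elim/big_rec2: _ => [|i s p _ IH]; first by rewrite msize1.
apply: msizeM_leS IH.
elim: (m i) => [|k IHk]; first by rewrite expr0 msize1.
by rewrite exprS mulSn; apply: msizeM_leS.
Qed.

(* Monomials with all exponents below [D] outnumber the monomials that can
   occur after substitution, because [D ^ n] beats [(c D) ^ p] for large [D]. *)
Lemma exists_algebraic_relation (F : fieldType) n p (G : 'I_n -> {mpoly F[p]}) :
  (p < n)%N ->
  exists2 q : {mpoly F[n]}, q != 0 & forall x, q.@[fun i => (G i).@[x]] = 0.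
Proof.
(* Products of the [G i] with exponents below [D] have degree below [S]. As [S <= D * (n * e).+1]
   and [D] exceeds [(n * e).+1 ^ p], one gets [S ^ p < D ^ p.+1 <= D ^ n]. *)
move=> pn; pose e := (\max_i msize (G i))%N.
pose D := (((n * e).+1 ^ p).+1)%N; pose S := (n * (D * e)).+1.
pose mon (f : {ffun 'I_n -> 'I_D}) := [multinom (f i : nat) | i < n].
pose mon' (f : {ffun 'I_p -> 'I_S}) := [multinom (f i : nat) | i < p].
pose Q (f : {ffun 'I_n -> 'I_D}) : {mpoly F[p]} := \prod_i G i ^+ f i.
have szQ f : (msize (Q f) <= S)%N.
  apply: leq_trans (@msize_prod_le _ _ e _ _ _ _) _ => [i|].
    by apply: leqW; apply: leq_bigmax.
  rewrite ltnS -[n in (_ <= n * _)%N]card_ord -sum_nat_const.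
  by apply: leq_sum => i _; rewrite leq_mul2r ltnW ?orbT.
(* Each row holds coefficients of one product [Q f], so a left kernel vector gives a linear relation
   among these products. *)
pose A := \matrix_(i < #|{ffun 'I_n -> 'I_D}|, j < #|{ffun 'I_p -> 'I_S}|)
   (Q (enum_val i))@_(mon' (enum_val j)).
have [|v v0 vA] := @exists_left_kernel _ _ _ A.
  rewrite !card_ffun !card_ord.
  have SD : (S <= D * (n * e).+1)%N by rewrite mulnS addnC /S -addn1 leq_add // mulnCA.
  apply: leq_ltn_trans (_ : _ <= (D * (n * e).+1) ^ p)%N _.
    by case: (p) => // p'; rewrite leq_exp2r.
  rewrite expnMn (leq_trans (_ : _ < D ^ p.+1)%N) ?leq_pexp2l //.
  by rewrite expnSr ltn_pmul2l ?expn_gt0 // ltnSn.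
pose q : {mpoly F[n]} := \sum_i v 0 i *: 'X_[mon (enum_val i)].
exists q.
  (* [mon] is injective, so no other term of [q] contributes to this coefficient, which is
     [v 0 i0]. *)
  case/rV0Pn: v0 => i0 hi; apply/eqP => /(congr1 (mcoeff (mon (enum_val i0)))).
  rewrite mcoeff0 raddf_sum (bigD1 i0) //= mcoeffZ mcoeffX eqxx mulr1 big1 ?addr0; last first.
    move=> i ne; rewrite mcoeffZ mcoeffX; case: eqP => [E|_]; last by rewrite mulr0.
    case/eqP: ne; apply: enum_val_inj; apply/ffunP => k; apply: val_inj.
    by move/mnmP/(_ k): E; rewrite !mnmE.
  by move/eqP; rewrite (negPf hi).
have rel : \sum_i v 0 i *: Q (enum_val i) = 0.
  apply/mpolyP => m; rewrite mcoeff0 raddf_sum /=.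
  (* By [szQ] no monomial of degree at least [S] occurs; any other has all exponents below [S] and
     labels a column of [A]. *)
  have [mS|Sm] := ltnP (mdeg m) S; last first.
    apply: big1 => i _; rewrite mcoeffZ memN_msupp_eq0 ?mulr0 //.
    by apply: msize_mdeg_ge; apply: leq_trans Sm.
  have lt i : (m i < S)%N.
    by apply: leq_ltn_trans mS; rewrite mdegE (bigD1 i) //= leq_addr.
  pose f := [ffun i => Ordinal (lt i)].
  have mf : mon' f = m by apply/mnmP => i; rewrite mnmE ffunE.
  have := congr1 (fun w : 'rV_ _ => w 0 (enum_rank f)) vA.
  rewrite !mxE => E; apply: etrans E; apply: eq_bigr => i _.
  by rewrite mcoeffZ mxE enum_rankK mf.
move=> x; have := congr1 (meval x) rel; rewrite meval0 => E; apply: etrans E.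
rewrite !raddf_sum /=; apply: eq_bigr => i _; rewrite !mevalZ mevalX; congr (_ * _).
by rewrite rmorph_prod; apply: eq_bigr => k _; rewrite rmorphXn mnmE.
Qed.

(** * Normalized solutions and the count of their free parameters *)

Section NormalizedSolutions.

Variables (C : numClosedFieldType) (K : nat) (M N d : 'I_K -> nat).
Variables (f : forall k, 'I_(d k) -> 'I_(N k)) (g : forall k, 'I_(d k) -> 'I_(M k)).
Arguments f : clear implicits.
Arguments g : clear implicits.
Hypotheses (inj_f : forall k, injective (f k)) (inj_g : forall k, injective (g k)).

(* [W k] stands for the conjugate transpose of [U k]. *)
Definition normalized_solution (H : channel C M N)
    (W : forall k, 'M[C]_(d k, N k)) (V : forall k, 'M[C]_(M k, d k)) :=
  [/\ forall k, colsub (f k) (W k) = 1%:M,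
      forall k, rowsub (g k) (V k) = 1%:M &
      forall k j, j != k -> W k *m H k j *m V j = 0].

Definition coordinate : finType :=
  ({k : 'I_K & ('I_(d k) * 'I_(N k))%type} +
   {k : 'I_K & ('I_(M k) * 'I_(d k))%type} + entry M N)%type.

(** One channel entry per scalar alignment equation: the entry for which that equation is solved. *)
Definition determined (e : entry M N) :=
  ((tag e).1 != (tag e).2) &&
  (((tagged e).1 \in codom (f (tag e).1)) && ((tagged e).2 \in codom (g (tag e).2))).

Definition free (x : coordinate) :=
  match x with
  | inl (inl w) => (tagged w).2 \notin codom (f (tag w))
  | inl (inr v) => (tagged v).1 \notin codom (g (tag v))
  | inr e => ~~ determined e
  end.

Definition parameter : finType := {x : coordinate | free x}.

Definition coordinate_value (H : channel C M N)
    (W : forall k, 'M[C]_(d k, N k)) (V : forall k, 'M[C]_(M k, d k)) (x : coordinate) :=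
  match x with
  | inl (inl w) => W (tag w) (tagged w).1 (tagged w).2
  | inl (inr v) => V (tag v) (tagged v).1 (tagged v).2
  | inr e => H (tag e).1 (tag e).2 (tagged e).1 (tagged e).2
  end.

Definition parameter_value H W V (i : 'I_#|{: parameter}|) :=
  coordinate_value H W V (val (enum_val i)).

(** The value 0 is a default outside the free coordinates, where there is no indeterminate. *)
Definition variable (x : coordinate) : {mpoly C[#|{: parameter}|]} :=
  if insub x is Some y then 'X_(enum_rank (y : parameter)) else 0.

Lemma variable_eval H W V x : free x ->
  (variable x).@[parameter_value H W V] = coordinate_value H W V x.
Proof.
move=> fx; rewrite /variable insubT mevalXU /parameter_value enum_rankK.
by rewrite SubK.
Qed.

Lemma receiver_entry_poly k a i : exists G : {mpoly C[#|{: parameter}|]},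
  forall H W V, normalized_solution H W V -> G.@[parameter_value H W V] = W k a i.
Proof.
have [/codomP[a' ->]|fi] := boolP (i \in codom (f k)).
  exists (a == a')%:R => H W V [/(_ k)/matrixP/(_ a a') E _ _].
  by rewrite rmorph_nat; move: E; rewrite !mxE.
exists (variable (inl (inl (Tagged (fun k => ('I_(d k) * 'I_(N k))%type) (a, i))))).
by move=> H W V _; rewrite variable_eval.
Qed.

Lemma transmitter_entry_poly k i a : exists G : {mpoly C[#|{: parameter}|]},
  forall H W V, normalized_solution H W V -> G.@[parameter_value H W V] = V k i a.
Proof.
have [/codomP[a' ->]|fi] := boolP (i \in codom (g k)).
  exists (a' == a)%:R => H W V [_ /(_ k)/matrixP/(_ a' a) E _].
  by rewrite rmorph_nat; move: E; rewrite !mxE.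
exists (variable (inl (inr (Tagged (fun k => ('I_(M k) * 'I_(d k))%type) (i, a))))).
by move=> H W V _; rewrite variable_eval.
Qed.

(* As [W k] and [V j] contain identity blocks, equation [(a, b)] of
   [W k *m H k j *m V j = 0] can be solved for the entry [(f a, g b)] of [H k j]. *)
Lemma determined_entryE H W V k j a b : normalized_solution H W V -> k != j ->
  H k j (f k a) (g j b) =
  - \sum_(il | ~~ ((il.1 \in codom (f k)) && (il.2 \in codom (g j))))
      W k a il.1 * H k j il.1 il.2 * V j il.2 b.
Proof.
move=> [hW hV hH] kj.
have: \sum_il W k a il.1 * H k j il.1 il.2 * V j il.2 b = 0.
  have jk : j != k by rewrite eq_sym.
  have /matrixP/(_ a b) := hH _ _ jk; rewrite !mxE => E.
  rewrite -(pair_bigA _ (fun i l => W k a i * H k j i l * V j l b)) exchange_big /=.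
  by apply: etrans E; apply: eq_bigr => l _; rewrite mxE big_distrl.
(* Among the positions in both codomains, the identity blocks kill every term except the one at
   [(f k a, g j b)], whose coefficient is 1. *)
rewrite (bigID (fun il => (il.1 \in codom (f k)) && (il.2 \in codom (g j)))) /=.
rewrite (bigD1 (f k a, g j b)) /= ?codom_f // big1 ?addr0.
  have /matrixP/(_ a a) := hW k; have /matrixP/(_ b b) := hV j; rewrite !mxE !eqxx => -> ->.
  by rewrite mul1r mulr1 => /eqP; rewrite addr_eq0 => /eqP.
case=> i l /= /andP[/andP[/codomP[a' ->] /codomP[b' ->]]].
have /matrixP/(_ a a') := hW k; have /matrixP/(_ b' b) := hV j; rewrite !mxE => -> ->.
have [->|_] := eqVneq a a'; last by rewrite !mul0r.
by have [->|_] := eqVneq b' b; rewrite ?eqxx ?mulr0.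
Qed.

(** The formula for a determined entry involves only undetermined entries of the same [H k j], so
    one substitution suffices, without recursion. *)
Lemma entry_poly (e : entry M N) : exists G : {mpoly C[#|{: parameter}|]},
  forall H W V, normalized_solution H W V -> G.@[parameter_value H W V] =
    H (tag e).1 (tag e).2 (tagged e).1 (tagged e).2.
Proof.
have [|fe] := boolP (determined e); last first.
  by exists (variable (inr e)) => H W V _; rewrite variable_eval.
case: e => -[k j] [i l] /=; rewrite /determined /=.
case/andP=> kj /andP[/codomP[a ->] /codomP[b ->]].
have [Gw hw] := fin_all_exists (receiver_entry_poly a).
have [Gv hv] := fin_all_exists (fun l' => transmitter_entry_poly l' b).
pose Gh (il : 'I_(N k) * 'I_(M j)) := variable (inr (Tagged
  (fun kj : 'I_K * 'I_K => ('I_(N kj.1) * 'I_(M kj.2))%type)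
  (il : 'I_(N (k, j).1) * 'I_(M (k, j).2)))).
exists (- \sum_(il | ~~ ((il.1 \in codom (f k)) && (il.2 \in codom (g j))))
      Gw il.1 * Gh il * Gv il.2) => H W V sol.
rewrite (determined_entryE a b sol kj) mevalN; congr (- _).
rewrite raddf_sum /=; apply: eq_bigr => il fil; rewrite !mevalM hw // hv // variable_eval //=.
by rewrite /determined /= kj.
Qed.

Lemma card_not_codom (m n : nat) (h : 'I_m -> 'I_n) : injective h ->
  (\sum_(i | i \notin codom h) 1 + m = n)%N.
Proof.
move=> ih; rewrite sum1_card -[X in (_ + X = _)%N](card_ord m) -(card_codom ih) addnC.
by rewrite cardC card_ord.
Qed.

Lemma card_determined : #|determined| = (\sum_(kj | kj.1 != kj.2) d kj.1 * d kj.2)%N.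
Proof.
rewrite -sum1_card -(sig_big_dep (fun kj : 'I_K * 'I_K => kj.1 != kj.2)
  (fun kj (il : 'I_(N kj.1) * 'I_(M kj.2)) =>
     (il.1 \in codom (f kj.1)) && (il.2 \in codom (g kj.2))) (fun _ _ => 1%N)) /=.
apply: eq_bigr => -[k j] _ /=.
rewrite -(pair_big (mem (codom (f k))) (mem (codom (g j))) (fun _ _ => 1%N)) /=.
by rewrite sum_nat_const sum1_card (card_codom (@inj_f k)) (card_codom (@inj_g j)) !card_ord.
Qed.

(** The identity blocks remove [d k ^ 2] entries from each [W k] and each [V k], and the equations
    remove the off-diagonal part of [(\sum_k d k) ^ 2]. The additive form avoids truncated
    subtraction. *)
Lemma card_parameter :
  (#|{: parameter}| + (\sum_k d k) ^ 2 + \sum_k d k ^ 2 =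
   #|{: entry M N}| + \sum_k d k * (M k + N k))%N.
Proof.
rewrite card_sig -sum1_card !big_sumType /=.
rewrite -(sig_big_dep predT (fun k (w : 'I_(d k) * 'I_(N k)) =>
  w.2 \notin codom (f k)) (fun _ _ => 1%N)) /=.
rewrite -(sig_big_dep predT (fun k (w : 'I_(M k) * 'I_(d k)) =>
  w.1 \notin codom (g k)) (fun _ _ => 1%N)) /=.
have eW : (\sum_(k : 'I_K) \sum_(w : 'I_(d k) * 'I_(N k) | w.2 \notin codom (f k)) 1 +
   \sum_k d k ^ 2 = \sum_k d k * N k)%N.
  rewrite -big_split; apply: eq_bigr => k _ /=.
  rewrite -(pair_big predT (fun i => i \notin codom (f k)) (fun _ _ => 1%N)) /=.
  by rewrite sum_nat_const card_ord -mulnn -mulnDr card_not_codom.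
have eV : (\sum_(k : 'I_K) \sum_(w : 'I_(M k) * 'I_(d k) | w.1 \notin codom (g k)) 1 +
   \sum_k d k ^ 2 = \sum_k d k * M k)%N.
  rewrite -big_split; apply: eq_bigr => k _ /=.
  rewrite (eq_bigl (fun w => (w.1 \notin codom (g k)) && predT w.2)) => [|w]; last by rewrite andbT.
  rewrite -(pair_big (fun i => i \notin codom (g k)) predT (fun _ _ => 1%N)) /=.
  rewrite exchange_big /= (eq_bigl predT) // sum_nat_const card_ord.
  by rewrite -mulnn -mulnDr card_not_codom.
have eD : ((\sum_k d k) ^ 2 = \sum_(kj | kj.1 != kj.2) d kj.1 * d kj.2 + \sum_k d k ^ 2)%N.
  rewrite -mulnn big_distrlr pair_bigA (bigID (fun kj => kj.1 != kj.2)) /=; congr addn.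
  rewrite -(pair_big_dep predT (fun k j => ~~ (k != j)) (fun k j => d k * d j)%N) /=.
  apply: eq_bigr => k _; rewrite (bigD1 k) ?negbK //= mulnn big1 ?addn0 // => j.
  by rewrite negbK eq_sym; case/andP=> ->.
have eM : (\sum_k d k * (M k + N k) = \sum_k d k * M k + \sum_k d k * N k)%N.
  by rewrite -big_split; apply: eq_bigr => k _; rewrite mulnDr.
have := cardC determined; rewrite card_determined.
rewrite -[#|[predC determined]|]sum1_card; move: eW eV eD eM => /=.
rewrite (eq_bigl (fun e => ~~ determined e)) // => <- <- -> -> eN.
rewrite -[#|{: entry M N}|]eN; lia.
Qed.

Lemma normalized_relation :
  (\sum_k d k * (M k + N k) < (\sum_k d k) ^ 2 + \sum_k d k ^ 2)%N ->
  exists2 q : {mpoly C[#|{: entry M N}|]}, q != 0 &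
    forall H W V, normalized_solution H W V -> q.@[coords H] = 0.
Proof.
move=> bad; have [G hG] := fin_all_exists entry_poly.
have [|q q0 hq] := @exists_algebraic_relation _ #|{: entry M N}| #|{: parameter}|
  (fun i => G (enum_val i)).
  by have := card_parameter; lia.
exists q => // H W V sol; rewrite -[RHS](hq (parameter_value H W V)).
by apply: meval_eq => i; rewrite (hG _ _ _ _ sol).
Qed.

End NormalizedSolutions.

(** * From alignment solutions to a polynomial equation on the channels *)

Lemma exists_unit_rowsub (F : fieldType) m n (A : 'M[F]_(m, n)) : \rank A = n ->
  exists2 h : {ffun 'I_n -> 'I_m}, injective h & rowsub h A \in unitmx.
Proof.
move=> /eqP rA; exists (fullrankfun rA); first exact: fullrankfun_inj.
exact: fullrowsub_unit.
Qed.

Lemma finite_union_vanishing (F : idomainType) n (T : finType) (X : Type)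
    (c : X -> 'I_n -> F) (Z : T -> X -> Prop) :
  (forall t, exists2 q : {mpoly F[n]}, q != 0 & forall x, Z t x -> q.@[c x] = 0) ->
  exists2 q : {mpoly F[n]}, q != 0 & forall t x, Z t x -> q.@[c x] = 0.
Proof.
case/fin_all_exists2 => q q0 hq; exists (\prod_t q t); first by apply/prodf_neq0 => t _.
by move=> t x Zx; rewrite rmorph_prod (bigD1 t) //= hq ?mul0r.
Qed.

Section Achievability.

Variables (C : numClosedFieldType) (K : nat) (M N : 'I_K -> nat).

Lemma coords_surjective (v : 'I_#|{: entry M N}| -> C) :
  exists H : channel C M N, coords H =1 v.
Proof.
exists (fun k j => \matrix_(a, b) v (enum_rank (Tagged
  (fun kj : 'I_K * 'I_K => ('I_(N kj.1) * 'I_(M kj.2))%type)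
  ((a, b) : 'I_(N (k, j).1) * 'I_(M (k, j).2)) : entry M N))) => i.
rewrite /coords mxE -[in RHS](enum_valK i).
by case: (enum_val i) => -[k j] [a b].
Qed.

(** The rank condition forces [V k] and [conjtr (U k)] to have full rank [d k], hence an invertible
    block each; multiplying by its inverse preserves the alignment equations. *)
Lemma LIA_achievable_normalized (H : channel C M N) d : LIA_achievable H d ->
  exists (f : {dffun forall k, {ffun 'I_(d k) -> 'I_(N k)}})
         (g : {dffun forall k, {ffun 'I_(d k) -> 'I_(M k)}}),
  [/\ forall k, injective (f k), forall k, injective (g k) &
      exists W V, normalized_solution (fun k => f k) (fun k => g k) H W V].
Proof.
case=> V [U [HUV rUV]]; pose W k := conjtr (U k).
have rV k : \rank (V k) = d k.
  by apply/eqP; rewrite eqn_leq rank_leq_col -[X in (X <= _)%N]rUV mxrankM_maxr.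
have rW k : \rank (W k)^T = d k.
  rewrite mxrank_tr; apply/eqP; rewrite eqn_leq rank_leq_row -[X in (X <= _)%N]rUV.
  by rewrite -mulmxA mxrankM_maxl.
have [f inj_f uW] := fin_all_exists2 (fun k => exists_unit_rowsub (rW k)).
have [g inj_g uV] := fin_all_exists2 (fun k => exists_unit_rowsub (rV k)).
exists (finfun f), (finfun g); split=> [k|k|]; rewrite ?ffunE //.
exists (fun k => invmx (colsub (f k) (W k)) *m W k), (fun k => V k *m invmx (rowsub (g k) (V k))).
split=> [k|k|k j jk]; rewrite ?ffunE.
- have -> (A : 'M_(d k)) : colsub (f k) (A *m W k) = A *m colsub (f k) (W k).
    by apply/matrixP => a b; rewrite !mxE; apply: eq_bigr => c _; rewrite [in RHS]mxE.
  by apply: mulVmx; rewrite -unitmx_tr trmx_mxsub.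
- have -> (A : 'M_(d k)) : rowsub (g k) (V k *m A) = rowsub (g k) (V k) *m A.
    by apply/matrixP => a b; rewrite !mxE; apply: eq_bigr => c _; rewrite mxE.
  exact: mulmxV.
- by rewrite !mulmxA -[_ *m W k *m _]mulmxA -[_ *m V j]mulmxA HUV // mulmx0 mul0mx.
Qed.

Lemma LIA_achievable_leq (H : channel C M N) d k : LIA_achievable H d -> (d k <= M k)%N.
Proof.
case=> V [U [_ /(_ k) r]]; rewrite -[X in (X <= _)%N]r.
by apply: leq_trans (mxrankM_maxr _ _) _; apply: rank_leq_row.
Qed.

Lemma infeasible_relation (d : 'I_K -> nat) :
  (\sum_k d k * (M k + N k) < (\sum_k d k) ^ 2 + \sum_k d k ^ 2)%N ->
  exists2 q : {mpoly C[#|{: entry M N}|]}, q != 0 &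
    forall H, LIA_achievable H d -> q.@[coords H] = 0.
Proof.
move=> bad.
pose T : finType := ({dffun forall k, {ffun 'I_(d k) -> 'I_(N k)}} *
                     {dffun forall k, {ffun 'I_(d k) -> 'I_(M k)}})%type.
pose Z (t : T) (H : channel C M N) :=
  [/\ forall k, injective (t.1 k), forall k, injective (t.2 k) &
      exists W V, normalized_solution (fun k => t.1 k) (fun k => t.2 k) H W V].
have [|q q0 hq] := @finite_union_vanishing _ _ _ _ (@coords C K M N) Z.
  move=> [f g].
  (* For a non-injective choice [Z] is empty, so the constant polynomial 1 serves. *)
  have [/forallP injf|ninj] := boolP [forall k, injectiveb (f k)]; last first.
    by exists 1; rewrite ?oner_eq0 // => H [inj _ _];
      case/forallP: ninj => k; apply/injectiveP; exact: inj.
  have [/forallP injg|ninj] := boolP [forall k, injectiveb (g k)]; last first.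
    by exists 1; rewrite ?oner_eq0 // => H [_ inj _];
      case/forallP: ninj => k; apply/injectiveP; exact: inj.
  have [|||q q0 hq] := @normalized_relation C K M N d (fun k => f k) (fun k => g k); last 1 first.
  - by exists q => // H [_ _ [W [V]]]; apply: hq.
  - by move=> k; apply/injectiveP.
  - by move=> k; apply/injectiveP.
  - by [].
exists q => // H /LIA_achievable_normalized[f [g hfg]]; exact: (hq (f, g)).
Qed.

(** A single open set must serve all [d] at once. Since [d k <= M k], finitely many tuples matter
    and one product of polynomials handles them. *)
Lemma generic_dof_bound : generic (fun H : channel C M N =>
  forall d, LIA_achievable H d ->
    ((\sum_k d k) ^ 2 + \sum_k d k ^ 2 <= \sum_k d k * (M k + N k))%N).
Proof.
pose B := (\sum_k M k).+1.
pose ok (d : {ffun 'I_K -> 'I_B}) :=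
  ((\sum_k d k) ^ 2 + \sum_k d k ^ 2 <= \sum_k d k * (M k + N k))%N.
have [|q q0 hq] := @finite_union_vanishing _ _ _ _ (@coords C K M N)
   (fun (d : {ffun 'I_K -> 'I_B}) H => ~~ ok d /\ LIA_achievable H (fun k => d k)).
  move=> d; case: (boolP (ok d)) => [_|]; first by exists 1; rewrite ?oner_eq0 // => H [].
  rewrite -ltnNge => /infeasible_relation[q q0 hq].
  by exists q => // H [_]; apply: hq.
exists (fun H => q.@[coords H] != 0); split.
- exists (eq q) => H; split=> [qH|[_ [<- //]]]; by exists q.
- have [v qv] := mpoly_nonzero_eval q0; have [H Hv] := coords_surjective v.
  by exists H; rewrite (meval_eq q Hv).
move=> H qH d dH.
have ltB k : (d k < B)%N.
  by rewrite ltnS (leq_trans (LIA_achievable_leq k dH)) // (bigD1 k) //= leq_addr.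
pose d' := [ffun k => Ordinal (ltB k)].
(* Equality of functions is needed because the types in [LIA_achievable H d] depend on [d]. *)
have dd' : d = fun k => d' k :> nat by apply: boolp.funext => k; rewrite ffunE.
rewrite {}dd' in dH *; apply/negPn/negP => nok.
by rewrite (hq d') ?eqxx in qH.
Qed.

End Achievability.

Theorem corollary1 (R : realType) (K : nat) (M N : 'I_K -> nat)
  (hK : (1 <= K)%N) (hM : forall k, (0 < M k)%N) (hN : forall k, (0 < N k)%N) :
  generic (fun H : channel R[i] M N =>
    (forall d : nat, LIA_achievable H (fun _ => d) ->
       (d%:R : rat) <=
         1 / (K%:R * (K%:R + 1)) * \sum_(k < K) ((M k)%:R + (N k)%:R))
    /\
    (forall m n : nat, (0 < m)%N -> (0 < n)%N ->
       (forall k, (M k + N k = m + n)%N) ->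
       forall d : 'I_K -> nat, LIA_achievable H d ->
         ((\sum_(k < K) d k) ^ 2 + \sum_(k < K) d k ^ 2
            <= (m + n) * \sum_(k < K) d k)%N
         /\ (\sum_(k < K) d k < m + n)%N)).
Proof.
have [O [openO neO subO]] := generic_dof_bound R[i] M N.
exists O; split=> // H /subO bound {O openO neO subO}; split.
  move=> d /bound; rewrite !sum_nat_const !card_ord -big_distrr /= => le.
  have K0 : (0 < K%:R * (K%:R + 1) :> rat) by rewrite natr1 -natrM ltr0n muln_gt0 hK.
  rewrite mul1r ler_pdivlMl // natr1.
  under eq_bigr do rewrite -natrD.
  rewrite -natr_sum -!natrM ler_nat.
  (* For positive [d], cancel one factor [d] in [(K * d) ^ 2 + K * d ^ 2 <= d * \sum_k (M k + N
     k)]. *)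
  by have [->|d0] := posnP d; [rewrite muln0 | rewrite -(leq_pmul2l d0); apply: leq_trans le; lia].
move=> m n m0 n0 mn d /bound.
have -> : (\sum_k d k * (M k + N k) = (m + n) * \sum_k d k)%N.
  by rewrite mulnC big_distrl; apply: eq_bigr => k _; rewrite mn.
move=> le; split=> //.
have [-> |S0] := posnP (\sum_k d k); first by rewrite addn_gt0 m0.
(* A positive [d k] makes the sum of squares positive; dropping it gives a strict inequality, from
   which one factor [\sum_k d k] cancels. *)
have [k dk] : exists k, (0 < d k)%N.
  by move: S0; rewrite lt0n sum_nat_eq0 => /forallPn[k]; rewrite -lt0n; exists k.
rewrite -(ltn_pmul2r S0); apply: leq_trans le; rewrite mulnn -addn1 leq_add2l.
by rewrite (bigD1 k) //= addn_gt0 expn_gt0 dk.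
Qed.
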